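(* Let $K$ be a line-free closed convex set in $\mathbb{R}^d$ and let $L$ be a $d$-dimensional closed convex set in $\mathbb{R}^d$. Let $R:=R_L(K)=\operatorname{conv}(K\setminus\operatorname{int}(L))$ and assume $R\neq\emptyset$. Then the following statements hold. I. For a point $x\in\mathbb{R}^d$ the following conditions are equivalent. (i) $x\in\operatorname{ext}(R)$. (ii) Either $x\in\operatorname{ext}(K)\setminus\operatorname{int}(L)$, or there exists a one-dimensional face $I$ of $K$ such that $I\setminus\{x\}$ consists of two connected components $I_1$ and $I_2$ which satisfy $I_1\subseteq\operatorname{int}(L)$ and $I_2\cap L=\emptyset$. II. If $\operatorname{rec}(L)$ is a linear space, then $R$ is closed, the recession cones of $R$ and $K$ coincide and, furthermore, one has $$R=\operatorname{conv}(\operatorname{ext}(R))+\operatorname{rec}(K),$$ $$R=\operatorname{conv}\bigl(\operatorname{ext}_1(K)\setminus\operatorname{int}(L)\bigr)+\operatorname{rec}(K).$$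
   Context: Here $d\in\mathbb{N}=\{1,2,\ldots\}$, and $\operatorname{conv}$, $\operatorname{int}$ denote convex hull and interior in $\mathbb{R}^d$. A closed convex set is line-free if it contains no line. The dimension of a convex set is the dimension of its affine hull. A point $x$ of a (not necessarily closed) convex set $C$ is extreme if there is no segment $I=[a,b]\subseteq C$ with $a\neq b$ and $x$ in the relative interior of $I$; $\operatorname{ext}(C)$ is the set of extreme points of $C$. A convex subset $F$ of a closed convex set $K$ is a face of $K$ if every segment $I\subseteq K$ whose relative interior meets $F$ satisfies $I\subseteq F$. For an integer $i\ge 0$, $\operatorname{ext}_i(K)$ is the union of all faces of $K$ of dimension at most $i$. The recession cone of a nonempty closed convex set $K$ is $\operatorname{rec}(K)=\{y\in\mathbb{R}^d : x+ty\in K \ \forall x\in K\ \forall t\ge 0\}$. The sum of two sets is the Minkowski sum. *)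

(* Defs.v *)
From HB Require Import structures.
From mathcomp Require Import all_boot all_order all_algebra.
From mathcomp Require Import all_classical all_reals all_analysis.
Set Implicit Arguments.
Unset Strict Implicit.
Unset Printing Implicit Defensive.
Import Order.TTheory GRing.Theory Num.Theory numFieldNormedType.Exports.
Local Open Scope classical_set_scope.
Local Open Scope ring_scope.

(* R^d is the space 'rV[R]_d of row vectors; the library's topology on it is
   the one of the sup norm, i.e. the usual one. *)

Section ConvexSets.
Context {R : realType} {d : nat}.
Local Notation E := 'rV[R]_d.
Implicit Types (A B C F I K L : set E) (a b v x y : E).

Definition convex C : Prop := @convex_set R E C.

Definition conv_hull A : set E := smallest convex A.

Definition affine_set A : Prop :=
  forall x y (t : R), A x -> A y -> A ((1 - t) *: x + t *: y).

Definition aff_hull A : set E := smallest affine_set A.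

(* The dimension is that of the linear space parallel to the affine hull. The
   empty set has no dimension here; this is harmless in ext_, where the empty
   face would contribute no point. *)
Definition has_dim A (k : nat) : Prop :=
  exists (x : E) (V : {vspace E}),
    \dim V = k /\ aff_hull A = [set x + v | v in [set` V]].

Definition relint A : set E :=
  [set x | A x /\ \forall y \near x, aff_hull A y -> A y].

Definition segment a b : set E :=
  [set (1 - t) *: a + t *: b | t in `[0, 1]%classic].

Definition line_free C : Prop :=
  ~ exists a v, v != 0 /\ [set a + t *: v | t in [set: R]] `<=` C.

Definition ext C : set E :=
  [set x | C x /\
    ~ exists a b, [/\ a != b, segment a b `<=` C & relint (segment a b) x]].

Definition face K F : Prop :=
  [/\ convex F, F `<=` K &
      forall a b, segment a b `<=` K ->
        relint (segment a b) `&` F !=set0 -> segment a b `<=` F].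

Definition ext_ (i : nat) K : set E :=
  [set x | exists F, [/\ face K F, exists2 k, (k <= i)%N & has_dim F k & F x]].

Definition rec_cone K : set E :=
  [set y | forall x (t : R), K x -> 0 <= t -> K (x + t *: y)].

Definition is_linear_space A : Prop := exists V : {vspace E}, A = [set` V].

Definition mink_add A B : set E := [set x + y | x in A & y in B].

Definition components A : set (set E) := [set connected_component A x | x in A].

Definition R_ L K : set E := conv_hull (K `\` L°).

End ConvexSets.

(* Main.v *)
Require Import Defs.
From HB Require Import structures.
From mathcomp Require Import all_boot all_order all_algebra finmap.
From mathcomp Require Import all_classical all_reals all_analysis.
From mathcomp Require Import ring lra.
Set Implicit Arguments.
Unset Strict Implicit.
Unset Printing Implicit Defensive.
Import Order.TTheory GRing.Theory Num.Theory numFieldNormedType.Exports.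
Local Open Scope classical_set_scope.
Local Open Scope ring_scope.

(** Extreme points. An extreme point [x] of [R_ L K] belongs to [K] and not to
    [L°], so some hyperplane through [x] misses [L°]. The part of [K] on this
    hyperplane is contained in [R_ L K]; hence [K] cannot extend to both sides
    of [x] along a direction of the hyperplane. The directions along which [K]
    extends to both sides of [x] form a linear space that meets a hyperplane
    trivially, so that it is zero, and [x] is extreme in [K], or it is a line,
    and [x] is inside an edge of [K] ([ext_R_line_direction], [face_of_line]).
    In the second case, extremality in [R_ L K] means that one side of the edge
    is swallowed by [L°] and that the other side is disjoint from [L].
    Conversely, on such an edge only the points of one side survive in
    [R_ L K], with [x] as their end ([ext_R_sub], [line_face_ext_R]).

    Recession cones. Every recession direction of [K] is one of [R_ L K]
    ([rec_cone_R_sup]): a half-line of [K] starting outside [L°] cannot stay in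
    [L°] from some point on, because its direction would be a recession
    direction of [L], and so would be the opposite direction.

    Closedness and generation. Two classical facts are proved for closed convex
    sets that may be unbounded. Klee's theorem ([klee]): such a set without
    lines is the sum of the convex hull of its extreme points and of its
    recession cone. Milman's theorem ([milman]): the extreme points of the
    closed convex hull of a closed set belong to that set. Let [Rbar] be the
    closure of [R_ L K]. It is contained in [K], so it has no lines and its
    recession directions are recession directions of [K], hence of [R_ L K].
    Its extreme points are in [K] outside [L°] by Milman's theorem, so
    Klee's theorem for [Rbar] yields [Rbar `<=` R_ L K]. Once [R_ L K] is known
    to be closed, Klee's theorem applies to it directly and gives the first
    representation. The second one follows since by the first part the extreme
    points of [R_ L K] lie on faces of [K] of dimension at most 1.

    Both classical facts rest on compactness. For Klee's theorem it enters
    through the separation of a point from an arbitrary convex set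
    ([separation]); for Milman's theorem through the fact that a segment
    passing near an extreme point has an end near it ([ext_ball]). *)

(** * Preliminaries on convex sets, extreme points and faces *)

(** Identities between linear combinations are checked coordinatewise. *)
Ltac vec := apply/rowP => ?; rewrite !mxE; ring.

Section Basics.
Context {R : realType} {d : nat}.
Local Notation E := 'rV[R]_d.
Implicit Types (A B C F I K L : set E) (u v x y a b : E) (s t : R).

Definition dot u v : R := \sum_i u 0 i * v 0 i.

Lemma dotDr u x y : dot u (x + y) = dot u x + dot u y.
Proof. by rewrite -big_split; apply: eq_bigr => i _; rewrite mxE mulrDr. Qed.

Lemma dotZr u (a : R) x : dot u (a *: x) = a * dot u x.
Proof. by rewrite mulr_sumr; apply: eq_bigr => i _; rewrite mxE mulrCA. Qed.

Lemma dotNr u x : dot u (- x) = - dot u x.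
Proof. by rewrite -scaleN1r dotZr mulN1r. Qed.

Lemma dotBr u x y : dot u (x - y) = dot u x - dot u y.
Proof. by rewrite dotDr dotNr. Qed.

Lemma dotC u v : dot u v = dot v u.
Proof. by apply: eq_bigr => i _; rewrite mulrC. Qed.

Lemma dot_gt0 u : (0 < dot u u) = (u != 0).
Proof.
apply/idP/idP => [|u0].
  apply: contraTneq => ->; rewrite -leNgt /dot big1// => i _.
  by rewrite mxE mul0r.
rewrite lt0r andbC sumr_ge0 => [|i _]; last by rewrite -expr2 sqr_ge0.
apply: contra u0; rewrite psumr_eq0 => [/allP H|i _]; last first.
  by rewrite -expr2 sqr_ge0.
apply/eqP/rowP => i; have := H i; rewrite mem_index_enum => /(_ isT).
by rewrite mulf_eq0 orbb mxE => /eqP.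
Qed.

Lemma dot_continuous u : continuous (dot u).
Proof.
have ct i : continuous (fun y : E => u 0 i * y 0 i).
  move=> y.
  have h : {for y, continuous (fun y : E => y 0 i)} by exact: coord_continuous.
  exact: (@cvgM _ _ (nbhs y) _ (fun=> _) (fun y : E => y 0 i) _ _ (cvg_cst _) h).
by apply: (@continuous_big R _ +%R 0 predT) => //; exact: add_continuous.
Qed.

Lemma convexP C : convex C <->
  forall x y t, C x -> C y -> 0 <= t <= 1 -> C ((1 - t) *: x + t *: y).
Proof.
split=> [cC x y t Cx Cy /andP[t0 t1]|H x y l /[!inE] Cx Cy].
  have s0 : 0 <= 1 - t by rewrite subr_ge0.
  have s1 : 1 - t <= 1 by rewrite gerBl.
  have := cC x y (Itv01 s0 s1).
  rewrite !inE => /(_ Cx Cy); congr C.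
  by rewrite /conv /= /unstable.onem; congr (_ + _ *: _); ring.
have := H x y (1 - l%:num) Cx Cy; rewrite subr_ge0 gerBl.
have -> : (l%:num <= 1) && (0 <= l%:num) by apply/andP.
move=> /(_ isT); congr C; rewrite /conv /= /unstable.onem.
by congr (_ *: _ + _); ring.
Qed.

Lemma convex_openP C : convex C <->
  forall x y t, C x -> C y -> 0 < t < 1 -> C ((1 - t) *: x + t *: y).
Proof.
rewrite convexP; split=> H x y t Cx Cy /andP[t0 t1].
  by apply: H => //; apply/andP; split; exact: ltW.
move: t0; rewrite le_eqVlt => /predU1P[<-|t0].
  by rewrite subr0 scale1r scale0r addr0.
move: t1; rewrite le_eqVlt => /predU1P[->|t1].
  by rewrite subrr scale1r scale0r add0r.
by apply: H => //; rewrite t0.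
Qed.

Lemma convex_comb C x y (a b : R) : convex C -> C x -> C y -> 0 <= a -> 0 <= b ->
  a + b = 1 -> C (a *: x + b *: y).
Proof.
move=> /convexP cC Cx Cy a0 b0 ab.
have -> : a = 1 - b by rewrite -ab; ring.
by apply: cC => //; rewrite b0 -ab; lra.
Qed.

(** The scaling is outside so that the statement still makes sense when both
    weights vanish. *)
Lemma convex_scaleD C x y (a b : R) : convex C -> C x -> C y -> 0 <= a -> 0 <= b ->
  exists2 z, C z & a *: x + b *: y = (a + b) *: z.
Proof.
move=> cC Cx Cy a0 b0; have [ab|ab] := eqVneq (a + b) 0.
  have -> : a = 0 by lra.
  have -> : b = 0 by lra.
  by exists x => //; vec.
exists ((a / (a + b)) *: x + (b / (a + b)) *: y).
  by apply: convex_comb => //; rewrite ?divr_ge0 ?addr_ge0//; field.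
by apply/rowP => i; rewrite !mxE; field.
Qed.

Lemma convex_conv_hull A : convex (conv_hull A).
Proof.
apply/convexP => x y t hx hy t01 B [cB AB].
by move/convexP: (cB); apply; [exact: hx|exact: hy|].
Qed.

Lemma sub_conv_hull A : A `<=` conv_hull A.
Proof. exact: sub_gen_smallest. Qed.

Lemma conv_hull_min A C : convex C -> A `<=` C -> conv_hull A `<=` C.
Proof. by move=> cC AC; exact: smallest_sub. Qed.

Lemma conv_hull_mono A B : A `<=` B -> conv_hull A `<=` conv_hull B.
Proof.
move=> AB; apply: conv_hull_min; first exact: convex_conv_hull.
exact: subset_trans AB (@sub_conv_hull B).
Qed.

Lemma segment_sub C a b : convex C -> C a -> C b -> segment a b `<=` C.
Proof.
by move=> /convexP cC Ca Cb _ [t /= + <-]; rewrite in_itv /=; exact: cC.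
Qed.

Lemma segmentl a b : segment a b a.
Proof. by exists 0; rewrite /= ?in_itv /= ?lexx ?ler01//; vec. Qed.

Lemma segmentr a b : segment a b b.
Proof. by exists 1; rewrite /= ?in_itv /= ?lexx ?ler01//; vec. Qed.

Lemma affine_comb_inj a b s t : a != b ->
  (1 - s) *: a + s *: b = (1 - t) *: a + t *: b -> s = t.
Proof.
move=> ab e; apply/eqP; rewrite -subr_eq0.
have : (s - t) *: (b - a) = 0.
  have -> : (s - t) *: (b - a) =
    ((1 - s) *: a + s *: b) - ((1 - t) *: a + t *: b) by vec.
  by rewrite e subrr.
by move/eqP; rewrite scaler_eq0 !subr_eq0 (eq_sym b) (negbTE ab) orbF.
Qed.

Lemma continuous_affine_comb a b : continuous (fun t => (1 - t) *: a + t *: b).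
Proof.
move=> t; apply: cvgD; apply: cvgZr_tmp; last exact: cvg_id.
by apply: cvgB; [exact: cvg_cst|exact: cvg_id].
Qed.

Lemma sub_aff_hull A : A `<=` aff_hull A.
Proof. exact: sub_gen_smallest. Qed.

Lemma affine_aff_hull A : affine_set (aff_hull A).
Proof. by move=> x y t hx hy B BP; apply: BP.1; [exact: hx|exact: hy]. Qed.

Lemma affine_line x v : affine_set [set x + t *: v | t in [set: R]].
Proof.
move=> _ _ t [r _ <-] [s _ <-]; exists ((1 - t) * r + t * s) => //; vec.
Qed.

(** At an end point the line leaves the segment, so an end point of a
    nondegenerate segment is not in its relative interior; a degenerate
    segment consists of its midpoint. *)
Lemma relint_segment a b x : relint (segment a b) x ->
  exists2 t, 0 < t < 1 & x = (1 - t) *: a + t *: b.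
Proof.
have [<- [[t _ <-] _]|ab] := eqVneq a b.
  by exists 2^-1; [lra|vec].
case=> -[t /= + <-]; rewrite in_itv /= => /andP[t0 t1] nearx.
have /(_ _ nearx) := @continuous_affine_comb a b t.
rewrite nbhs_simpl /= => -[e /= e0 he].
have key s : `|t - s| < e -> 0 <= s <= 1.
  move=> /he /(_ _)[].
    by apply: affine_aff_hull; apply: sub_aff_hull;
      [exact: segmentl|exact: segmentr].
  by move=> r; rewrite /= in_itv /= => + /(affine_comb_inj ab) <-.
exists t => //; apply/andP; split.
  have : 0 <= t - e / 2 <= 1 by apply: key; rewrite opprB addrC subrK ger0_norm; lra.
  by lra.
have : 0 <= t + e / 2 <= 1.
  by apply: key; rewrite opprD addNKr normrN ger0_norm; lra.
by lra.
Qed.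

(** Parametrizing the line by [a + r (b - a)], the inequalities [0 < r < 1]
    read as strict inequalities for the inner product with [b - a], and these
    persist near the given point. *)
Lemma open_segment_relint a b t : a != b -> 0 < t < 1 ->
  relint (segment a b) ((1 - t) *: a + t *: b).
Proof.
move=> ab /andP[t0 t1]; split.
  by exists t => //=; rewrite in_itv /= !ltW.
pose w : E := b - a.
have w0 : 0 < dot w w by rewrite dot_gt0 subr_eq0 eq_sym.
set p := _ + _.
have ep : dot w p = dot w a + t * dot w w.
  by rewrite -dotZr -dotDr; congr dot; rewrite /p /w; vec.
have H0 : \forall y \near p, dot w a < dot w y.
  apply: (cvgr_gt _ (@dot_continuous w p)).
  by rewrite ep ltrDl mulr_gt0.
have H1 : \forall y \near p, dot w y < dot w b.
  apply: (cvgr_lt _ (@dot_continuous w p)).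
  rewrite ep (_ : b = a + w); last by rewrite /w; vec.
  by rewrite dotDr ltrD2l gtr_pMl.
near=> y => hy.
have [] : [set a + t *: (b - a) | t in [set: R]] y.
  apply: hy; split; first exact: affine_line.
  by move=> _ [r _ <-]; exists r => //; vec.
move=> r _ ey; exists r; last by rewrite -ey; vec.
have h0 : dot w a < dot w y by near: y.
have h1 : dot w y < dot w b by near: y.
have dy : dot w y = dot w a + r * dot w w by rewrite -dotZr -dotDr ey.
move: h0 h1; rewrite dy (_ : b = a + w); last by rewrite /w; vec.
rewrite dotDr ltrDl ltrD2l pmulr_lgt0// gtr_pMl// => r0 r1.
by rewrite /= in_itv /= !ltW.
Unshelve. all: by end_near. Qed.

Lemma midpoint_neq x v : v != 0 -> x - v != x + v.
Proof.
apply: contra => /eqP e; have : 2 *: v = 0 :> E.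
  have -> : 2 *: v = (x + v) - (x - v) by vec.
  by rewrite -e subrr.
by move/eqP; rewrite scaler_eq0 pnatr_eq0.
Qed.

(** A segment with [x] in its relative interior contains one that is centred
    at [x] and has the same direction. *)
Lemma extP C x : convex C -> ext C x <->
  C x /\ forall v, C (x + v) -> C (x - v) -> v = 0.
Proof.
move=> cC; split=> -[Cx H]; split=> //.
  move=> v Cp Cm; apply/eqP; apply: contrapT => /negP v0; apply: H.
  exists (x - v), (x + v); split; first exact: midpoint_neq.
    exact: segment_sub.
  have mid : (1 - 2^-1) *: (x - v) + 2^-1 *: (x + v) = x.
    by apply/rowP => ?; rewrite !mxE; field.
  rewrite -[X in relint _ X]mid.
  by apply: open_segment_relint; [exact: midpoint_neq|lra].
move=> -[a [b [ab abC /relint_segment[t t01 ex]]]].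
have Ca := abC _ (segmentl a b); have Cb := abC _ (segmentr a b).
(* [b - a] scaled by the largest factor that fits on both sides of [x] *)
pose e := Num.min t (1 - t).
have e0 : 0 < e by rewrite lt_min; lra.
have et : e <= t by rewrite ge_min lexx.
have e1t : e <= 1 - t by rewrite ge_min lexx orbT.
move/convexP: cC => cC.
have : e *: (b - a) = 0.
  apply: H.
    have -> : x + e *: (b - a) = (1 - (t + e)) *: a + (t + e) *: b by rewrite ex; vec.
    by apply: cC => //; lra.
  have -> : x - e *: (b - a) = (1 - (t - e)) *: a + (t - e) *: b by rewrite ex; vec.
  by apply: cC => //; lra.
by move/eqP; rewrite scaler_eq0 gt_eqF//= subr_eq0 eq_sym (negbTE ab).
Qed.

Lemma ext_comb C x a b t : convex C -> ext C x -> C a -> C b -> 0 < t < 1 ->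
  x = (1 - t) *: a + t *: b -> a = x /\ b = x.
Proof.
move=> cC [Cx H] Ca Cb t01 ex.
have [ab|ab] := eqVneq a b.
  have -> : x = b by rewrite ex ab; vec.
  by [].
exfalso; apply: H; exists a, b; split=> //; first exact: segment_sub.
by rewrite ex; exact: open_segment_relint.
Qed.

Lemma face_comb K F a b t : convex K -> face K F -> K a -> K b -> 0 < t < 1 ->
  F ((1 - t) *: a + t *: b) -> F a /\ F b.
Proof.
move=> cK [cF FK H] Ka Kb t01 Fx.
have [ab|ab] := eqVneq a b.
  have eb : (1 - t) *: a + t *: b = b by rewrite ab; vec.
  by rewrite eb in Fx; rewrite ab.
have h : segment a b `<=` F.
  apply: H; first exact: segment_sub.
  by exists ((1 - t) *: a + t *: b); split=> //; exact: open_segment_relint.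
by split; apply: h; [exact: segmentl|exact: segmentr].
Qed.

Lemma faceI K F : convex F -> F `<=` K ->
  (forall a b t, K a -> K b -> 0 < t < 1 ->
     F ((1 - t) *: a + t *: b) -> F a /\ F b) -> face K F.
Proof.
move=> cF FK H; split=> // a b abK [p [/relint_segment[t t01 ->] Fp]].
have [Fa Fb] := H a b t (abK _ (segmentl a b)) (abK _ (segmentr a b)) t01 Fp.
exact: segment_sub.
Qed.

Lemma has_dim_set1 x : has_dim [set x] 0.
Proof.
exists x, 0%VS; split; first exact: dimv0.
apply/seteqP; split=> [y hy|_ [v /= + <-]].
  suff -> : y = x by exists 0; rewrite ?addr0//= memv0.
  have : [set x] y by apply: hy; split=> // _ _ t -> ->; rewrite /=; vec.
  by [].
rewrite memv0 => /eqP ->; rewrite addr0; exact: sub_aff_hull.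
Qed.

Lemma has_dim_line I x v : v != 0 -> I x -> I (x + v) ->
  I `<=` [set x + t *: v | t in [set: R]] -> has_dim I 1.
Proof.
move=> v0 Ix Iv Iline; exists x, <[v]>%VS; split; first by rewrite dim_vline v0.
apply/seteqP; split=> [y hy|_ [w /= /vlineP[t ->] <-]].
  have [t _ <-] : [set x + t *: v | t in [set: R]] y.
    by apply: hy; split=> //; exact: affine_line.
  by exists (t *: v) => //=; exact: memvZ (memv_line _).
have -> : x + t *: v = (1 - t) *: x + t *: (x + v) by vec.
by apply: affine_aff_hull; exact: sub_aff_hull.
Qed.

Lemma has_dim1 I : has_dim I 1 -> exists2 v : E, v != 0 &
  forall x y, I x -> I y -> exists t, y = x + t *: v.
Proof.
move=> [x0 [V [dV eV]]]; pose v := vpick V.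
have V0 : V != 0%VS by rewrite -dimv_eq0 dV.
have v0 : v != 0 by rewrite vpick0.
have eVv : V = <[v]>%VS.
  by apply/esym/eqP; rewrite eqEdim -memvE memv_pick dim_vline v0 dV.
exists v => // x y /(@sub_aff_hull I) + /(@sub_aff_hull I).
rewrite eV eVv => -[_ /= /vlineP[s ->] <-] [_ /= /vlineP[t ->] <-].
by exists (t - s); vec.
Qed.

End Basics.

(** * Separation of a point from a convex set *)

Section Separation.
Context {R : realType} {d : nat}.
Local Notation E := 'rV[R]_d.
Implicit Types (A C : set E) (u v x y : E).

Lemma convex_sum C m (l : 'I_m -> R) (c : 'I_m -> E) : convex C -> C !=set0 ->
  (forall i, 0 <= l i) -> (forall i, C (c i)) ->
  0 <= \sum_i l i /\
  exists2 y, C y & \sum_i l i *: c i = (\sum_i l i) *: y.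
Proof.
move=> cC [y0 Cy0] l0 Cc.
apply: (big_ind2 (fun (v : E) (L : R) => 0 <= L /\ exists2 y, C y & v = L *: y)).
- by split=> //; exists y0 => //; rewrite scale0r.
- move=> _ L1 _ L2 [L10 [y1 C1 ->]] [L20 [y2 C2 ->]].
  split; first exact: addr_ge0.
  exact: convex_scaleD.
- by move=> i _; split=> //; exists (c i).
Qed.

Lemma norm_coord_le m (v : 'rV[R]_m) i : `|v 0 i| <= `|v|.
Proof.
rewrite [leRHS]/Num.norm /= mx_normrE; apply/bigmax_geP; right => /=.
by exists (0, i).
Qed.

Lemma closed_halfspace m (u : 'rV[R]_m) (a : R) : closed [set x | a <= dot u x].
Proof.
exact: ((continuous_closedP (dot u)).1 (@dot_continuous R m u) _ (@closed_ge _ a)).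
Qed.

Lemma closed_hyperplane m (u : 'rV[R]_m) (a : R) : closed [set x | dot u x = a].
Proof.
exact: ((continuous_closedP (dot u)).1 (@dot_continuous R m u) _ (@closed_eq _ a)).
Qed.

Lemma compact_simplex m :
  compact [set l : 'rV[R]_m | (forall i, 0 <= l 0 i) /\ \sum_i l 0 i = 1].
Proof.
apply: bounded_closed_compact.
  exists 1; split => // M M1 l [l0 l1] /=.
  rewrite [leLHS]/Num.norm /= mx_normrE; apply/bigmax_leP; split.
    by rewrite ltW// (lt_trans ltr01).
  move=> [i j] _ /=; rewrite ord1 ger0_norm// (le_trans _ (ltW M1))// -l1.
  by rewrite (bigD1 j)//= lerDl sumr_ge0.
have -> : [set l : 'rV[R]_m | (forall i, 0 <= l 0 i) /\ \sum_i l 0 i = 1] =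
  (\bigcap_(i in [set: 'I_m]) [set l : 'rV[R]_m | 0 <= dot (delta_mx 0 i) l]) `&`
  [set l : 'rV[R]_m | dot (const_mx 1) l = 1].
  have e1 i (l : 'rV[R]_m) : dot (delta_mx 0 i) l = l 0 i.
    rewrite /dot (bigD1 i)//= mxE !eqxx mul1r big1 ?addr0// => j ji.
    by rewrite mxE (negbTE ji) andbF mul0r.
  have e2 (l : 'rV[R]_m) : dot (const_mx 1) l = \sum_i l 0 i.
    by apply: eq_bigr => i _; rewrite mxE mul1r.
  apply/seteqP; split=> l /= [l0 l1]; split.
  - by move=> i _ /=; rewrite e1.
  - by rewrite e2.
  - by move=> i; rewrite -e1; exact: l0.
  - by rewrite -e2.
apply: closedI; first (apply: closed_bigI => i _).
  exact: closed_halfspace.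
exact: closed_hyperplane.
Qed.

(** The point of smallest Euclidean norm in the convex hull of the [c i] exists
    because the hull is the continuous image of a simplex; it is nonzero since
    the hull lies in [C], and it forms an acute angle with every [c i]. *)
Lemma separation_finite C m (c : 'I_m -> E) : (0 < d)%N -> convex C -> ~ C 0 ->
  (forall i, C (c i)) -> exists2 u, u != 0 & forall i, 0 <= dot u (c i).
Proof.
move=> d0 cC C0 Cc.
case: m c Cc => [|m] c Cc.
  exists (const_mx 1); last by case.
  case: d d0 => // n _; apply/eqP => /rowP/(_ 0)/eqP.
  by rewrite !mxE oner_eq0.
pose comb (l : 'rV[R]_m.+1) : E := \sum_i l 0 i *: c i.
set S := [set l : 'rV[R]_m.+1 | (forall i, 0 <= l 0 i) /\ \sum_i l 0 i = 1].
have [] := @EVT_min_rV R _ (fun l => dot (comb l) (comb l)) S.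
- exists (delta_mx 0 0); split=> [i|]; first by rewrite mxE.
  rewrite (bigD1 0)//= mxE !eqxx big1 ?addr0// => j j0.
  by rewrite mxE (negbTE j0).
- exact: compact_simplex.
- apply: continuous_subspaceT.
  have ct j : continuous (fun l => comb l 0 j).
    have -> : (fun l => comb l 0 j) = dot (\row_i c i 0 j).
      apply/funext => k; rewrite /comb /dot summxE; apply: eq_bigr => i _.
      by rewrite !mxE mulrC.
    exact: dot_continuous.
  apply: (@continuous_big R _ +%R 0 predT (@add_continuous R^o)) => j _ l.
  exact: (@cvgM _ _ (nbhs l) _ _ _ _ _ (ct j l) (ct j l)).
move=> l /[!inE] -[l0 l1] lmin.
have Ccomb k : S k -> C (comb k).
  move=> [k0 k1]; have [] := @convex_sum C _ (k 0) c cC _ k0 Cc.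
    by exists (c 0).
  by rewrite k1 /comb => _ [y Cy ->]; rewrite scale1r.
have x0 : comb l != 0.
  by apply: contra_not_neq C0 => <-; apply: Ccomb.
exists (comb l) => // i.
have xx : 0 < dot (comb l) (comb l) by rewrite dot_gt0.
rewrite leNgt; apply/negP => dneg.
(* moving from the nearest point towards [c i] would decrease the norm *)
pose q := dot (comb l) (c i); pose n := dot (comb l) (comb l).
have step t : 0 <= t <= 1 ->
    n <= dot ((1 - t) *: comb l + t *: c i) ((1 - t) *: comb l + t *: c i).
  move=> t01; have -> : (1 - t) *: comb l + t *: c i =
      comb ((1 - t) *: l + t *: delta_mx 0 i).
    rewrite /comb !scaler_sumr.
    under [RHS]eq_bigr do rewrite !mxE scalerDl -!scalerA.
    rewrite big_split /=; congr (_ + _).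
    rewrite (bigD1 i)//= !eqxx scale1r big1 ?addr0// => j ji.
    by rewrite (negbTE ji) scale0r scaler0.
  apply: lmin; rewrite inE; split.
    by move=> j; rewrite !mxE addr_ge0 ?mulr_ge0//; lra.
  under eq_bigr do rewrite !mxE; rewrite big_split /= -!mulr_sumr l1.
  rewrite (bigD1 i)//= !eqxx big1 ?addr0 ?mulr1 ?subrK// => j ji.
  by rewrite (negbTE ji).
have expand t : dot ((1 - t) *: comb l + t *: c i) ((1 - t) *: comb l + t *: c i) =
    (1 - t) ^+ 2 * n + 2 * t * (1 - t) * q + t ^+ 2 * dot (c i) (c i).
  rewrite dotDr !dotZr !(dotC (_ + _)) !dotDr !dotZr -/n (dotC (c i)) -/q.
  by ring.
have r0 : 0 <= dot (c i) (c i) by rewrite sumr_ge0// => j _; rewrite -expr2 sqr_ge0.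
set r := dot (c i) (c i) in expand r0.
have nr : 0 < n + r by rewrite ltr_wpDr.
(* a step length for which the quadratic in [t] drops below [n] *)
have t01 : 0 <= n / (n + r) <= 1.
  by rewrite divr_ge0 ?(ltW nr) ?(ltW xx)//= ler_pdivrMr// mul1r lerDl.
have := step _ t01; rewrite expand -subr_ge0.
have -> : (1 - n / (n + r)) ^+ 2 * n + 2 * (n / (n + r)) * (1 - n / (n + r)) * q
   + (n / (n + r)) ^+ 2 * r - n = (n / (n + r)) * (2 * (r / (n + r)) * q - n).
  by field; rewrite gt_eqF.
rewrite leNgt => /negP; apply; rewrite pmulr_rlt0 ?divr_gt0//.
have : 2 * (r / (n + r)) * q <= 0.
  apply: mulr_ge0_le0; last exact: ltW.
  by apply: mulr_ge0 => //; apply: divr_ge0 => //; exact: ltW.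
by rewrite -/n in xx; lra.
Qed.

(** Each [c] in [C] restricts [u] to a closed half of the unit sphere.
    Finitely many of these halves meet, by the finite case above, hence all of
    them meet by compactness. *)
Lemma separation C : (0 < d)%N -> convex C -> ~ C 0 ->
  exists2 u, u != 0 & forall c, C c -> 0 <= dot u c.
Proof.
move=> d0 cC C0.
have unit_norm u : u != 0 -> `| `|u|^-1 *: u| = 1.
  by move=> u0; rewrite normrZ normfV normr_id mulVf ?normr_eq0.
have unit_compact : compact [set u : E | `|u| = 1].
  apply: bounded_closed_compact; first by exists 1; split => // M M1 u /= ->; exact: ltW.
  exact: ((continuous_closedP _).1 (@norm_continuous _ E) _ (@closed_eq _ 1)).
have [C0E|/set0P Cne] := eqVneq C set0.
  have [] := @separation_finite C 0 (fun=> 0) d0 cC C0; first by case.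
  by move=> u u0 _; exists u => // c; rewrite C0E.
have := unit_compact; rewrite compact_In0 => /(_ E C (fun c =>
  [set u : E | `|u| = 1] `&` [set u | 0 <= dot c u])).
case.
- exists (fun c => [set u | 0 <= dot c u]) => // c _; exact: closed_halfspace.
- move=> D DC.
  pose c (i : 'I_(size (enum_fset D))) : E := nth 0 (enum_fset D) i.
  have Cc i : C (c i).
    by apply/set_mem/DC; exact: mem_nth.
  have [u u0 hu] := separation_finite d0 cC C0 Cc.
  exists (`|u|^-1 *: u) => x /= Dx; split; first exact: unit_norm.
  have /(nthP 0)[i isz <-] : x \in enum_fset D by [].
  by rewrite /= dotZr dotC mulr_ge0 ?invr_ge0//; exact: (hu (Ordinal isz)).
move=> u hu; case: Cne => c0 Cc0.
have [u1 _] := hu c0 Cc0.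
exists u; first by rewrite -normr_eq0 u1 oner_eq0.
by move=> c /hu[_]; rewrite /= dotC.
Qed.

End Separation.

(** * Closed convex sets without lines are generated by extreme points *)

Section Klee.
Context {R : realType} {d : nat}.
Local Notation E := 'rV[R]_d.
Implicit Types (A C F : set E) (u v w x y p : E) (s t : R).

Lemma dot_mulmx u x : x *m u^T = (dot u x)%:M.
Proof.
by apply/matrixP => i j; rewrite !ord1 !mxE /dot mulr1n; apply: eq_bigr => k _;
  rewrite mxE mulrC.
Qed.

Lemma sub_kermx_dot u x : (x <= kermx u^T)%MS = (dot u x == 0).
Proof.
rewrite sub_kermx dot_mulmx; apply/eqP/eqP => [/matrixP/(_ 0 0)|->].
  by rewrite !mxE.
by rewrite raddf0.
Qed.

(** Separation by a functional that is not constant on a given subspace [V]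
    containing [C]. A functional nonnegative on [C] plus a complement of [V]
    must vanish on that complement, hence cannot vanish on [V]. *)
Lemma separation_in (V : 'M[R]_d) C : (0 < d)%N -> convex C -> C !=set0 ->
    ~ C 0 -> (forall c, C c -> (c <= V)%MS) ->
  exists2 u, (forall c, C c -> 0 <= dot u c) &
             exists2 w, (w <= V)%MS & dot u w != 0.
Proof.
move=> d0 cC [c0 Cc0] C0 CV.
pose D := [set c + w | c in C & w in [set w : E | (w <= V^C)%MS]].
have cD : convex D.
  apply/convexP => _ _ t [c1 C1 [w1 /= V1 <-]] [c2 C2 [w2 /= V2 <-]] t01.
  exists ((1 - t) *: c1 + t *: c2); first by move/convexP: cC; exact.
  exists ((1 - t) *: w1 + t *: w2); last by vec.
  by rewrite /= addmx_sub// scalemx_sub.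
have D0 : ~ D 0.
  move=> [c Cc [w /= wV cw0]]; apply: C0.
  have cE : c = - w by apply/eqP; rewrite -addr_eq0 cw0.
  have : (c <= V :&: V^C)%MS.
    by rewrite sub_capmx CV//= cE eqmx_opp.
  by rewrite capmx_compl submx0 => /eqP c_0; rewrite c_0 in Cc.
have [u u0 hu] := separation d0 cD D0.
exists u => [c Cc|].
  by apply: hu; exists c => //; exists 0; rewrite ?addr0//= sub0mx.
have uVC w : (w <= V^C)%MS -> dot u w = 0.
  move=> wV; apply/eqP; apply: contrapT => /negP uw0.
  have : 0 <= dot u (c0 + (- (dot u c0 + 1) / dot u w) *: w).
    apply: hu; exists c0 => //; eexists; last reflexivity.
    by rewrite /= scalemx_sub.
  by rewrite dotDr dotZr divfK//; lra.
apply: contrapT => H; move/negP: u0; apply; apply: contraT => u0; exfalso.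
have : (u <= V + V^C)%MS by rewrite submx_full// addsmx_compl_full.
move=> /sub_addsmxP[[a b] /= eu].
have := u0; rewrite -dot_gt0 {2}eu dotDr (uVC (b *m V^C)%MS) ?submxMl// addr0.
apply/negP; rewrite -leNgt le_eqVlt; apply/orP; left; apply: contraT => ua.
by exfalso; apply: H; exists (a *m V); rewrite ?submxMl.
Qed.

(** For closed convex sets, one half-line decides about all parallel ones: the
    point [x + t v] is the limit, as [s] tends to 0, of points on segments from
    [x] to the points [x0 + (t / s) v] far away on the given half-line. *)
Lemma rec_cone_from C x0 v : closed C -> convex C -> C x0 ->
  (forall t, 0 <= t -> C (x0 + t *: v)) -> rec_cone C v.
Proof.
move=> clC /convexP cC Cx0 Cv x t Cx t0.
have -> : x + t *: v = (1 - 0) *: (x + t *: v) + 0 *: (x0 + t *: v) by vec.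
pose f s := (1 - s) *: (x + t *: v) + s *: (x0 + t *: v).
apply: (@closed_cvg _ _ (0^'+) _ f C clC _ (f 0)).
  near=> s; have s0 : 0 < s by [].
  have -> : f s = (1 - s) *: x + s *: (x0 + (t / s) *: v).
    by apply/rowP => i; rewrite /f !mxE; field; rewrite gt_eqF.
  apply: cC => //; first by apply: Cv; rewrite divr_ge0// ltW.
  by rewrite ltW//=; near: s; apply: nbhs_right_le.
apply: cvg_at_right_filter; exact: continuous_affine_comb.
Unshelve. all: by end_near. Qed.

Lemma rec_coneD C u v : rec_cone C u -> rec_cone C v -> rec_cone C (u + v).
Proof. by move=> hu hv x t Cx t0; rewrite scalerDr addrA; apply: hv => //; apply: hu. Qed.

Lemma rec_coneZ C v a : 0 <= a -> rec_cone C v -> rec_cone C (a *: v).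
Proof. by move=> a0 hv x t Cx t0; rewrite scalerA; apply: hv => //; exact: mulr_ge0. Qed.

Lemma rec_cone0 C : rec_cone C 0.
Proof. by move=> x t Cx _; rewrite scaler0 addr0. Qed.

Lemma convex_mink_rec A C : convex A -> convex (mink_add A (rec_cone C)).
Proof.
move=> /convexP cA.
apply/convexP => _ _ t [a1 A1 [b1 B1 <-]] [a2 A2 [b2 B2 <-]] t01.
exists ((1 - t) *: a1 + t *: a2); first exact: cA.
exists ((1 - t) *: b1 + t *: b2); last by vec.
by apply: rec_coneD; apply: rec_coneZ => //; lra.
Qed.

Lemma exit_point C x v t0 : closed C -> convex C -> C x -> 0 <= t0 ->
  ~ C (x + t0 *: v) ->
  exists2 t, 0 <= t & C (x + t *: v) /\ forall s, 0 < s -> ~ C (x + (t + s) *: v).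
Proof.
move=> clC /convexP cC Cx t00 nC.
pose T := [set t | C (x + t *: v)].
have clT : closed T.
  have -> : T = (fun t => (1 - t) *: x + t *: (x + v)) @^-1` C.
    by apply/seteqP; split=> t /=; congr C; vec.
  exact: ((continuous_closedP _).1 (@continuous_affine_comb _ _ x (x + v)) _ clC).
have kT : compact (`[0, t0]%classic `&` T).
  by apply: compact_closedI => //; exact: segment_compact.
have [||t] := @compact_EVT_max _ R id _ _ kT.
- by exists 0; split; [rewrite /= in_itv /= lexx|rewrite /T /= scale0r addr0].
- by apply: continuous_subspaceT => r; exact: cvg_id.
move=> /[!inE] -[]; rewrite /= in_itv /= => /andP[tge tle] Tt tmax.
exists t => //; split=> // s s0 Cs.
have [tst|tst] := leP (t + s) t0.
  have : t + s <= t; last by lra.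
  by apply: tmax; rewrite inE; split=> //=; rewrite in_itv /= tst addr_ge0// ltW.
apply: nC; have -> : x + t0 *: v =
    (1 - (t0 - t) / s) *: (x + t *: v) + ((t0 - t) / s) *: (x + (t + s) *: v).
  by apply/rowP => i; rewrite !mxE; field; rewrite gt_eqF.
apply: cC => //; rewrite divr_ge0 ?subr_ge0 ?(ltW s0)//=.
by rewrite ler_pdivrMr// mul1r; lra.
Qed.

(** The half-line leaving [C] at [p] is disjoint from [C]; separating the two
    gives a hyperplane through [p] that cuts out a proper face. The functional
    is not constant on [V], so the face has fewer directions than [C]. *)
Lemma supporting_hyperplane (V : 'M[R]_d) C p v : (0 < d)%N -> convex C ->
    (forall x y, C x -> C y -> (y - x <= V)%MS) -> (v <= V)%MS -> C p ->
    (forall s, 0 < s -> ~ C (p + s *: v)) ->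
  exists2 u, (forall c, C c -> dot u c <= dot u p) &
             exists2 w, (w <= V)%MS & dot u w != 0.
Proof.
move=> d0 /convexP cC CV vV Cp exitp.
pose D := [set z | exists c s, [/\ C c, 0 < s & z = p + s *: v - c]].
have cD : convex D.
  apply/convexP => _ _ t [c1 [s1 [C1 S1 ->]]] [c2 [s2 [C2 S2 ->]]] t01.
  exists ((1 - t) *: c1 + t *: c2), ((1 - t) * s1 + t * s2).
  split; [exact: cC| by nra|by vec].
have [|||u hu [w wV uw]] := @separation_in V D d0 cD.
- by exists (p + 1 *: v - p), p, 1; split.
- move=> [c [s [Cc s0 e]]]; apply: (exitp s s0).
  by have -> : p + s *: v = c by apply/eqP; rewrite -subr_eq0 -e.
- move=> _ [c [s [Cc s0 ->]]]; rewrite addrAC addmx_sub ?scalemx_sub//.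
  exact: CV.
exists u; last by exists w.
move=> c Cc; rewrite leNgt; apply/negP => lt.
(* so small that moving by [s v] cannot make up for the gap between [c] and [p] *)
pose s := (dot u c - dot u p) / (2 * (`|dot u v| + 1)).
have k0 : 0 < `|dot u v| + 1 by rewrite ltr_wpDl.
have s0 : 0 < s by rewrite divr_gt0 ?subr_gt0// mulr_gt0.
have : 0 <= dot u (p + s *: v - c) by apply: hu; exists c, s.
rewrite dotBr dotDr dotZr.
have : s * dot u v <= s * (`|dot u v| + 1).
  by rewrite ler_pM2l//; have := ler_norm (dot u v); lra.
have -> : s * (`|dot u v| + 1) = (dot u c - dot u p) / 2.
  by rewrite /s; field; rewrite gt_eqF.
by lra.
Qed.

(** Klee's theorem, by induction on the rank of a matrix [V] whose row space
    contains all the differences of points of [C]. A point where [C] can be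
    left lies on a lower dimensional face, to which induction applies. If [C]
    has at least two points, each of its points is on a line that leaves [C] in
    at least one direction, so that it lies between two exit points or is an
    exit point plus a recession direction. *)
Lemma klee C : (0 < d)%N -> closed C -> convex C -> line_free C ->
  C `<=` mink_add (conv_hull (ext C)) (rec_cone C).
Proof.
move=> d0; have CV x y : C x -> C y -> (y - x <= (1%:M : 'M[R]_d))%MS.
  by move=> _ _; exact: submx1.
move: CV; have [n] := ubnP (\rank (1%:M : 'M[R]_d)).
elim: n (1%:M) C => // n IH V C rV CV clC cC lfC x Cx.
set G := mink_add _ _.
have cG : convex G by apply: convex_mink_rec; exact: convex_conv_hull.
have Gboundary p v : (v <= V)%MS -> C p -> (forall s, 0 < s -> ~ C (p + s *: v)) ->
    G p.
  move=> vV Cp exitp.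
  have [u hu [w wV uw]] := supporting_hyperplane d0 cC CV vV Cp exitp.
  pose F := C `&` [set c | dot u c = dot u p].
  have Fp : F p by split.
  have clF : closed F by apply: closedI => //; exact: closed_hyperplane.
  have cF : convex F.
    apply/convexP => y z t [Cy uy] [Cz uz] t01; split.
      by move/convexP: cC; exact.
    by move: uy uz; rewrite /= dotDr !dotZr => -> ->; ring.
  have lfF : line_free F.
    move=> [a [b [b0 ab]]]; apply: lfC; exists a, b; split=> //.
    by move=> y /ab[].
  have [||a aF [b bF eab]] := IH (V :&: kermx u^T)%MS F _ _ clF cF lfF p Fp.
  - apply: (leq_trans _ (rV : (\rank V <= n)%N)); apply: rank_ltmx.
    rewrite ltmxE capmxSl /=; apply: contra uw => VV'.
    by have := submx_trans wV VV'; rewrite sub_capmx sub_kermx_dot => /andP[].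
  - move=> y z [Cy uy] [Cz uz]; rewrite sub_capmx CV//= sub_kermx_dot.
    by rewrite dotBr uy uz subrr.
  exists a; last exists b => //.
    apply: conv_hull_mono aF => y /(extP _ cF)[[Cy uy] hy].
    apply/(extP _ cC); split=> // z Cp' Cm.
    have uz : dot u z = 0.
      have := hu _ Cp'; have := hu _ Cm; rewrite dotBr dotDr uy.
      by move: (dot u z) => r; lra.
    by apply: hy; split=> //=; rewrite ?dotDr ?dotNr uz ?oppr0 addr0.
  by apply: (rec_cone_from clC cC Cp) => t t0; have [] := bF p t Fp t0.
have GD y z : G y -> rec_cone C z -> G (y + z).
  move=> [a Ga [b Gb <-]] Cz; exists a => //; exists (b + z); last by rewrite addrA.
  exact: rec_coneD.
have Gdir v t0 : (v <= V)%MS -> 0 <= t0 -> ~ C (x + t0 *: v) -> G x.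
  move=> vV t00 nC.
  have [t1 t10 [C1 exit1]] := exit_point clC cC Cx t00 nC.
  have G1 : G (x + t1 *: v).
    by apply: (Gboundary _ v) => // s s0; rewrite -addrA -scalerDl; exact: exit1.
  have [Call|] := pselect (forall t, 0 <= t -> C (x + t *: - v)).
    have -> : x = (x + t1 *: v) + t1 *: - v by vec.
    by apply: GD => //; apply: rec_coneZ => //; exact: (rec_cone_from clC cC Cx).
  move=> /existsNP[t /not_implyP[t_0 nC']].
  have [t2 t20 [C2 exit2]] := exit_point clC cC Cx t_0 nC'.
  have G2 : G (x + t2 *: - v).
    apply: (Gboundary _ (- v)); rewrite ?eqmx_opp// => s s0.
    by rewrite -addrA -scalerDl; exact: exit2.
  have [t120|t120] := eqVneq (t1 + t2) 0.
    have t1_0 : t1 = 0 by lra.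
    by move: G1; rewrite t1_0 scale0r addr0.
  have -> : x = (t2 / (t1 + t2)) *: (x + t1 *: v) + (t1 / (t1 + t2)) *: (x + t2 *: - v).
    by apply/rowP => i; rewrite !mxE; field.
  by apply: convex_comb => //; rewrite ?divr_ge0 ?addr_ge0//; field.
have [Call|] := pselect (forall y, C y -> y = x).
  exists x; last by exists 0; [exact: rec_cone0|rewrite addr0].
  apply: sub_conv_hull; apply/(extP _ cC); split=> // v /Call e _.
  by apply: (addrI x); rewrite e addr0.
move=> /existsNP[y /not_implyP[Cy yx]].
have vV : (y - x <= V)%MS by exact: CV.
have [Call|] := pselect (forall t, C (x + t *: (y - x))).
  exfalso; apply: lfC; exists x, (y - x); split; first by rewrite subr_eq0; exact/eqP.
  by move=> _ [t _ <-].
move=> /existsNP[t nC]; have [t0|t0] := leP 0 t; first exact: Gdir nC.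
apply: (Gdir (- (y - x)) (- t)); rewrite ?eqmx_opp ?oppr_ge0 ?(ltW t0)//.
by rewrite scalerN scaleNr opprK.
Qed.

End Klee.

(** * Extreme points of closed convex hulls *)

Section Milman.
Context {R : realType} {d : nat}.
Local Notation E := 'rV[R]_d.
Implicit Types (A C D M : set E) (u v w x y p : E) (r s t e : R).

Lemma closure_normP A x : closure A x <->
  forall e, 0 < e -> exists2 y, A y & `|x - y| < e.
Proof.
split=> [cAx e e0|H B /nbhs_normP[e /= e0 eB]].
  have [y [Ay xy]] := cAx _ (nbhsx_ballx x e e0).
  by exists y => //; move: xy; rewrite -ball_normE.
by have [y Ay xy] := H e e0; exists y; split=> //; exact: eB.
Qed.

Lemma convex_closure A : convex A -> convex (closure A).
Proof.
move=> /convexP cA; apply/convexP => x y t /closure_normP cx /closure_normP cy t01.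
apply/closure_normP => e e0.
have e20 : 0 < e / 2 by rewrite divr_gt0.
have [x' Ax xx'] := cx _ e20; have [y' Ay yy'] := cy _ e20.
exists ((1 - t) *: x' + t *: y'); first exact: cA.
have -> : (1 - t) *: x + t *: y - ((1 - t) *: x' + t *: y') =
  (1 - t) *: (x - x') + t *: (y - y') by vec.
move/andP: t01 => [t0 t1]; have t1' : 0 <= 1 - t by rewrite subr_ge0.
apply: le_lt_trans (ler_normD _ _) _; rewrite !normrZ !ger0_norm//.
have := ler_wpM2l t1' (ltW xx'); have := ler_wpM2l t0 (ltW yy'); lra.
Qed.

(** A segment of [C] passing close to an extreme point [x] ends close to [x].
    Otherwise it contains a segment of length [r] centred at a point [p] close
    to [x]; by compactness of the sphere of radius [r / 2] this is impossible
    for [p] near [x], because it is impossible for [p = x]. *)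
Lemma ext_ball C x r : closed C -> convex C -> ext C x -> 0 < r ->
  exists2 e, 0 < e & forall a b t, C a -> C b -> 0 <= t <= 1 ->
    r <= `|x - a| -> r <= `|x - b| -> e <= `|x - ((1 - t) *: a + t *: b)|.
Proof.
move=> clC cC /(extP _ cC)[Cx extx] r0.
pose S := [set w : E | `|w| = r / 2].
have kS : compact S.
  apply: bounded_closed_compact.
    by exists (r / 2); split=> [|M M1 u /= ->]; [exact: num_real|exact: ltW].
  exact: ((continuous_closedP _).1 (@norm_continuous _ E) _ (@closed_eq _ (r / 2))).
have : \forall p \near x, S `<=` [set w | ~ (C (p + w) /\ C (p - w))].
  have oC : open (~` C) by rewrite openC.
  move/compact_near_coveringP: kS => kS.
  apply: (kS E (nbhs x) (fun p w => ~ (C (p + w) /\ C (p - w)))) => w /= Sw.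
  have w0 : w != 0.
    by apply: contra_eq_neq Sw => ->; rewrite normr0 eq_sym; lra.
  have [nC|nC] : ~ C (x + w) \/ ~ C (x - w).
    by apply/not_andP => -[h1 h2]; move/eqP: w0; apply; exact: extx.
  - have : \forall z \near (w, x), (~` C) (z.2 + z.1).
      have ct : {for (w, x), continuous (fun z : E * E => z.2 + z.1)}.
        by apply: continuousD; [exact: cvg_snd|exact: cvg_fst].
      by apply: ct; exact: open_nbhs_nbhs.
    by apply: filterS => -[w' p] /= h [].
  - have : \forall z \near (w, x), (~` C) (z.2 - z.1).
      have ct : {for (w, x), continuous (fun z : E * E => z.2 - z.1)}.
        by apply: continuousB; [exact: cvg_snd|exact: cvg_fst].
      by apply: ct; exact: open_nbhs_nbhs.
    by apply: filterS => -[w' p] /= h [].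
move=> /nbhs_normP[e0 /= e00 he].
exists (Num.min e0 (r / 2)); first by rewrite lt_min e00; lra.
move=> a b t Ca Cb t01 ra rb; rewrite leNgt; apply/negP.
set p := (1 - t) *: a + t *: b; rewrite lt_min => /andP[/he /= hp xp].
move/andP: t01 => [t0 t1]; have t1' : 0 <= 1 - t by rewrite subr_ge0.
have pa : r / 2 <= t * `|a - b|.
  have <- : `|t *: (a - b)| = t * `|a - b| by rewrite normrZ ger0_norm.
  have -> : t *: (a - b) = (x - p) - (x - a) by rewrite /p; vec.
  by rewrite distrC; have := lerB_dist (x - a) (x - p); lra.
have pb : r / 2 <= (1 - t) * `|a - b|.
  have <- : `|(1 - t) *: (a - b)| = (1 - t) * `|a - b| by rewrite normrZ ger0_norm.
  have -> : (1 - t) *: (a - b) = (x - b) - (x - p) by rewrite /p; vec.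
  by have := lerB_dist (x - b) (x - p); lra.
have ab0 : 0 < `|a - b| by nra.
(* the parameter length that makes the half-length equal to [r / 2] *)
pose s := r / 2 / `|a - b|.
have st : s <= t by rewrite /s ler_pdivrMr.
have s1t : s <= 1 - t by rewrite /s ler_pdivrMr.
have s0 : 0 <= s by rewrite /s divr_ge0// ltW// divr_gt0.
move/convexP: cC => cC.
apply: (hp (s *: (a - b))).
  by rewrite /S /= normrZ ger0_norm// divfK// gt_eqF.
split.
  have -> : p + s *: (a - b) = (1 - (t - s)) *: a + (t - s) *: b by rewrite /p; vec.
  by apply: cC => //; lra.
have -> : p - s *: (a - b) = (1 - (t + s)) *: a + (t + s) *: b by rewrite /p; vec.
by apply: cC => //; lra.
Qed.

Lemma convex_join C D : convex C -> convex D ->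
  convex [set z | exists a b t, [/\ C a, D b, 0 <= t <= 1 & z = (1 - t) *: a + t *: b]].
Proof.
move=> cC cD; apply/convexP => _ _ t
  [a1 [b1 [t1 [Ca1 Db1 t101 ->]]]] [a2 [b2 [t2 [Ca2 Db2 t201 ->]]]] t01.
have [||a Ca ea] := @convex_scaleD _ _ C a1 a2 ((1 - t) * (1 - t1)) (t * (1 - t2)) cC Ca1 Ca2.
  1-2: by rewrite mulr_ge0//; lra.
have [||b Db eb] := @convex_scaleD _ _ D b1 b2 ((1 - t) * t1) (t * t2) cD Db1 Db2.
  1-2: by rewrite mulr_ge0//; lra.
exists a, b, ((1 - t) * t1 + t * t2); split=> //; first by nra.
have -> : 1 - ((1 - t) * t1 + t * t2) = (1 - t) * (1 - t1) + t * (1 - t2) by ring.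
by rewrite -ea -eb; vec.
Qed.

(** Adding the sets one at a time, every point of the new hull lies on a
    segment whose two ends stay away from [x], so the previous lemma keeps
    the hull itself away from [x]. *)
Lemma ext_avoid_hull C x r (I : eqType) (f : I -> set E) (s : seq I) :
    closed C -> convex C -> ext C x -> 0 < r ->
    (forall i, convex (f i)) -> (forall i, f i `<=` C) ->
    (forall i y, f i y -> r <= `|x - y|) ->
  exists M, [/\ convex M, M `<=` C, (forall i, i \in s -> f i `<=` M) &
                exists2 e, 0 < e & forall y, M y -> e <= `|x - y|].
Proof.
move=> clC cC extx r0 cf fC fr.
elim: s => [|i s [M [cM MC sM [e e0 eM]]]].
  exists set0; split; [by move=> y z l; rewrite inE|exact: sub0set|by []|].
  by exists 1.
have [M0|/set0P[m0 Mm0]] := eqVneq M set0.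
  exists (f i); split=> //; last by exists r => // y /fr.
  move=> j; rewrite inE => /predU1P[->//|/sM fM] y /fM.
  by rewrite M0.
have [f0|/set0P[c0 fc0]] := eqVneq (f i) set0.
  exists M; split=> //; last by exists e.
  move=> j; rewrite inE => /predU1P[->|/sM//].
  by rewrite f0; exact: sub0set.
exists [set z | exists a b t, [/\ M a, f i b, 0 <= t <= 1 & z = (1 - t) *: a + t *: b]].
split.
- exact: convex_join.
- move=> _ [a [b [t [Ma fb t01 ->]]]].
  by move/convexP: cC; apply=> //; [exact: MC|exact: (fC i)].
- move=> j; rewrite inE => /predU1P[-> y fy|/sM fM y /fM My].
    by exists m0, y, 1; split=> //; [rewrite lexx ler01|vec].
  by exists y, c0, 0; split=> //; [rewrite lexx ler01|vec].
have [|e' e'0 he'] := @ext_ball C x (Num.min e r) clC cC extx.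
  by rewrite lt_min e0.
exists e' => // _ [a [b [t [Ma fb t01 ->]]]].
apply: he' => //; [exact: MC|exact: (fC i)| |]; rewrite ge_min.
  by rewrite eM.
by rewrite (fr i) ?orbT.
Qed.

(** Milman's theorem. If [x] were not in the closed set [A], the complement of
    a ball of the sup norm around [x] would cover [A]; this complement is a
    finite union of half-spaces, and by the previous lemma the hull of their
    traces on [C] stays away from [x]. *)
Lemma milman C A x : closed C -> convex C -> A `<=` C -> closed A ->
  ext C x -> closure (conv_hull A) x -> A x.
Proof.
move=> clC cC AC clA extx /closure_normP clx; apply: contrapT => nAx.
have [r r0 hr] : exists2 r, 0 < r & forall y, A y -> r <= `|x - y|.
  have : nbhs x (~` A) by apply: open_nbhs_nbhs; split=> //; rewrite openC.
  move=> /nbhs_normP[r /= r0 hr]; exists r => // y Ay.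
  by rewrite leNgt; apply/negP => /hr; apply.
pose sgn (b : bool) : R := if b then 1 else -1.
pose f (i : 'I_d * bool) := C `&` [set y | r <= sgn i.2 * (x 0 i.1 - y 0 i.1)].
have [|||M [cM MC fM [e e0 eM]]] :=
    @ext_avoid_hull C x r _ f (enum {: 'I_d * bool}) clC cC extx r0.
- move=> [i b]; apply/convexP => y z t [Cy ry] [Cz rz] t01; split.
    by move/convexP: cC; exact.
  move: ry rz; rewrite /= !mxE; set X := x 0 i; set Y := y 0 i; set Z := z 0 i.
  have -> : sgn b * (X - ((1 - t) * Y + t * Z)) =
    (1 - t) * (sgn b * (X - Y)) + t * (sgn b * (X - Z)) by ring.
  by nra.
- by move=> i y [].
- move=> [i b] y [_ /= ry]; apply: le_trans ry _.
  apply: le_trans (ler_norm _) _; rewrite normrM.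
  have -> : `|sgn b| = 1 by case: b; rewrite /sgn ?normrN1 ?normr1.
  rewrite mul1r; have -> : x 0 i - y 0 i = (x - y) 0 i by rewrite !mxE.
  exact: norm_coord_le.
have AM : A `<=` M.
  move=> y Ay; have rxy := hr y Ay.
  have xy0 : mx_norm (x - y) != 0 by rewrite gt_eqF// (lt_le_trans r0).
  have [[i0 j] /= ej] := mx_norm_neq0 xy0; rewrite ord1 in ej.
  pose b := 0 <= x 0 j - y 0 j.
  have {}ej : `|x - y| = `|x 0 j - y 0 j| by rewrite [LHS]ej !mxE.
  apply: (fM (j, b)); first by rewrite mem_enum.
  split; first exact: AC.
  rewrite /= (le_trans rxy)// ej /sgn /b; case: (lerP 0 (x 0 j - y 0 j)) => h.
    by rewrite mul1r ger0_norm.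
  by rewrite mulN1r ltr0_norm.
have [y /(conv_hull_min cM AM) /eM] := clx e e0.
by rewrite leNgt => /negP.
Qed.

End Milman.

(** * Interiors, and the components of a punctured line segment *)

Section Interior.
Context {R : realType} {d : nat}.
Local Notation E := 'rV[R]_d.
Implicit Types (A C I K L : set E) (u v w x y z : E) (s t e : R).

Lemma interior_normP C x : C° x <-> exists2 e, 0 < e & forall y, `|x - y| < e -> C y.
Proof.
split=> [/nbhs_normP[e /= e0 he]|[e e0 he]]; first by exists e.
by apply: (nbhs_normP x C).2; exists e.
Qed.

(** Around [(1 - t) y + t z], the ball around [y] reappears shrunk by the
    factor [1 - t]. *)
Lemma interior_comb L y z t : convex L -> L° y -> L z -> 0 <= t < 1 ->
  L° ((1 - t) *: y + t *: z).
Proof.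
move=> /convexP cL /interior_normP[e e0 he] Lz /andP[t0 t1].
have t1' : 0 < 1 - t by rewrite subr_gt0.
apply/interior_normP; exists ((1 - t) * e); first exact: mulr_gt0.
set p := _ + _ => q pq; pose y' := y - (1 - t)^-1 *: (p - q).
have -> : q = (1 - t) *: y' + t *: z.
  by apply/rowP => i; rewrite !mxE; field; rewrite gt_eqF.
apply: cL => //; last by rewrite t0 ltW.
apply: he; rewrite /y' opprB addrC subrK normrZ ger0_norm ?invr_ge0 ?(ltW t1')//.
by rewrite ltr_pdivrMl.
Qed.

Lemma convex_interior L : convex L -> convex L°.
Proof.
move=> cL; apply/convex_openP => y z t Ly Lz /andP[t0 t1].
by apply: interior_comb => //; [exact: interior_subset|rewrite ltW].
Qed.

Lemma interior_rec L y v : L° y -> rec_cone L v -> L° (y + v).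
Proof.
move=> /interior_normP[e e0 he] Lv; apply/interior_normP; exists e => // q yq.
have -> : q = (q - v) + 1 *: v by vec.
apply: Lv => //; apply: he.
by have -> : y - (q - v) = y + v - q by vec.
Qed.

(** Weak separation becomes strict because [L°] is open. *)
Lemma separation_interior L x : (0 < d)%N -> convex L -> ~ L° x ->
  exists u, forall y, L° y -> dot u x < dot u y.
Proof.
move=> d0 cL Lx.
have cD : convex [set y - x | y in L°].
  apply/convexP => _ _ t [y Ly <-] [z Lz <-] t01.
  exists ((1 - t) *: y + t *: z); last by vec.
  by move/convexP: (convex_interior cL); apply.
have [|u u0 hu] := separation d0 cD.
  by move=> [y Ly yx]; apply: Lx; rewrite -(subrK x y) yx add0r in Ly.
exists u => y Ly; move/interior_normP: (Ly) => [e e0 he].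
have un : 0 < `|u| by rewrite normr_gt0.
pose k := e / (2 * `|u|).
have k0 : 0 < k by rewrite divr_gt0// mulr_gt0.
have : L° (y - k *: u).
  apply/interior_normP; exists (e / 2); first by rewrite divr_gt0.
  move=> q yq; apply: he.
  have -> : y - q = (y - k *: u - q) + k *: u by vec.
  apply: le_lt_trans (ler_normD _ _) _; rewrite normrZ (gtr0_norm k0).
  have -> : k * `|u| = e / 2 by rewrite /k; field; rewrite gt_eqF.
  by lra.
move=> Ly'; have := hu _ (imageP (fun y => y - x) Ly').
have : 0 < k * dot u u by rewrite mulr_gt0// dot_gt0.
by rewrite !dotBr dotZr; lra.
Qed.

(** Removing an extreme point from a convex set leaves a convex set, so [A]
    cannot miss an extreme point of its hull. *)
Lemma ext_conv_hull A x : ext (conv_hull A) x -> A x.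
Proof.
move=> extx; apply: contrapT => nAx.
have cA := @convex_conv_hull _ _ A.
have /conv_hull_min : convex (conv_hull A `\ x).
  apply/convex_openP => a b t [Aa ax] [Ab bx] t01; split.
    by move/convex_openP: cA; exact.
  by move=> /esym /(ext_comb cA extx Aa Ab t01)[/ax].
move=> /(_ A) H; have [] : (conv_hull A `\ x) x; last by move=> _; exact.
apply: H; last by case: extx.
by move=> y Ay; split; [exact: sub_conv_hull|move=> yx; apply: nAx; rewrite -yx].
Qed.

Lemma convex_connected C : convex C -> connected C.
Proof.
move=> cC; have [->|/set0P[c0 Cc0]] := eqVneq C set0; first exact: connected0.
have -> : C = \bigcup_(c in C) segment c0 c.
  apply/seteqP; split=> [c Cc|y [c Cc]]; first by exists c => //; exact: segmentr.
  exact: segment_sub.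
apply: bigcup_connected; first by exists c0 => c _; exact: segmentl.
move=> c _; apply: connected_continuous_connected; first exact: segment_connected.
by apply: continuous_subspaceT; exact: continuous_affine_comb.
Qed.

Definition ray I x v : set E := I `&` [set x + s *: v | s in [set s | 0 < s]].

Lemma convex_ray I x v : convex I -> convex (ray I x v).
Proof.
move=> /convexP cI; apply/convexP => y z t [Iy [r /= r0 ey]] [Iz [s /= s0 ez]] t01.
split; first exact: cI.
exists ((1 - t) * r + t * s); last by rewrite -ey -ez; vec.
by rewrite /=; nra.
Qed.

Lemma ray_sub I x v : v != 0 -> ray I x v `<=` I `\ x.
Proof.
move=> v0 y [Iy [s /= s0 ey]]; split=> // yx; move: ey => /eqP.
by rewrite yx -subr_eq0 addrC addKr scaler_eq0 (negbTE v0) orbF gt_eqF.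
Qed.

(** A connected set meeting both sides would have a point at which the inner
    product with [v] takes its value at [x], and [x] itself is excluded. *)
Lemma ray_component I x v y : convex I -> v != 0 ->
    (forall z, I z -> exists s, z = x + s *: v) -> ray I x v y ->
  connected_component (I `\ x) y = ray I x v.
Proof.
move=> cI v0 Iline Iy.
have vv : 0 < dot v v by rewrite dot_gt0.
have dotE s : dot v (x + s *: v) = dot v x + s * dot v v by rewrite dotDr dotZr.
apply/seteqP; split=> [z cz|]; last first.
  apply: connected_component_max => //; last exact/convex_connected/convex_ray.
  exact: ray_sub.
have Tsub := @connected_component_sub _ (I `\ x) y.
have [Iz zx] := Tsub z cz.
have [s ez] := Iline z Iz; split=> //; exists s => //=.
have s0 : s != 0 by apply: contra_not_neq zx => s0; rewrite ez s0 scale0r addr0.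
rewrite lt_def s0 /= leNgt; apply/negP => sneg.
have yI : (I `\ x) y by exact: ray_sub Iy.
case: Iy => Iy [r /= r0 ey].
have /connected_intervalP : connected [set dot v q | q in connected_component (I `\ x) y].
  apply: connected_continuous_connected; first exact: component_connected.
  by apply: continuous_subspaceT; exact: dot_continuous.
move=> itv.
have [q Tq eq] : [set dot v q | q in connected_component (I `\ x) y] (dot v x).
  apply: (itv (dot v z) (dot v y)); first by exists z.
    by exists y => //; exact: connected_component_refl.
  by rewrite ez -ey !dotE; apply/andP; split; nra.
have [Iq qx] := Tsub q Tq; have [k ek] := Iline q Iq.
apply: qx; move: eq; rewrite ek dotE => /eqP.
rewrite -subr_eq0 addrC addKr mulf_eq0 (gt_eqF vv) orbF => /eqP ->.
by rewrite scale0r addr0.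
Qed.

Lemma components_line I x v : convex I -> v != 0 ->
    (forall z, I z -> exists s, z = x + s *: v) ->
    I (x + v) -> I (x - v) ->
  components (I `\ x) = [set ray I x v; ray I x (- v)].
Proof.
move=> cI v0 Iline Ip Im.
have v0' : - v != 0 by rewrite oppr_eq0.
have Iline' z : I z -> exists s, z = x + s *: - v.
  by move=> /Iline[s ->]; exists (- s); rewrite scalerN scaleNr opprK.
have rp : ray I x v (x + v) by split=> //; exists 1; rewrite /= ?ltr01// scale1r.
have rm : ray I x (- v) (x - v) by split=> //; exists 1; rewrite /= ?ltr01// scale1r.
apply/seteqP; split=> [_ [y [Iy yx] <-]|_ [->|->]].
- have [s ey] := Iline y Iy.
  have s0 : s != 0 by apply: contra_not_neq yx => s0; rewrite ey s0 scale0r addr0.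
  have [s_lt|s_gt] := ltP s 0.
    right; apply: ray_component => //; split=> //.
    by exists (- s); rewrite /= ?oppr_gt0// scalerN scaleNr opprK.
  left; apply: ray_component => //; split=> //.
  by exists s; rewrite //= lt_def s0.
- by exists (x + v); [exact: ray_sub rp|exact: ray_component].
- by exists (x - v); [exact: ray_sub rm|exact: ray_component].
Qed.

(** Conversely, two distinct components force [x] to be a point of [I] between
    them, since otherwise [I `\ x = I] is connected. *)
Lemma components_line_rays I x I1 I2 : convex I -> has_dim I 1 -> I1 <> I2 ->
    components (I `\ x) = [set I1; I2] ->
  I x /\ exists v, [/\ v != 0, forall z, I z -> exists s, z = x + s *: v,
    ray I x v `<=` I1, ray I x (- v) `<=` I2 & ray I x (- v) !=set0].
Proof.
move=> cI /has_dim1[v v0 Iline] I12 comp.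
have [y1 Iy1 e1] : components (I `\ x) I1 by rewrite comp; left.
have [y2 Iy2 e2] : components (I `\ x) I2 by rewrite comp; right.
have Ix : I x.
  apply: contrapT => nIx; apply: I12; rewrite -e1 -e2.
  have IE : I `\ x = I.
    by apply/seteqP; split=> [y []//|y Iy]; split=> // yx; apply: nIx; rewrite -yx.
  move: Iy1 Iy2; rewrite IE => Iy1 Iy2.
  by rewrite !connected_component_id//; exact: convex_connected.
have side y : (I `\ x) y -> ray I x v y \/ ray I x (- v) y.
  move=> [Iy yx]; have [s ey] := Iline x y Ix Iy.
  have s0 : s != 0 by apply: contra_not_neq yx => s0; rewrite ey s0 scale0r addr0.
  have [s_lt|s_gt] := ltP s 0; [right|left]; split=> //.
    by exists (- s); rewrite /= ?oppr_gt0// scalerN scaleNr opprK.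
  by exists s; rewrite //= lt_def s0.
have rc w y : w = v \/ w = - v -> ray I x w y ->
    connected_component (I `\ x) y = ray I x w.
  move=> [->|->]; apply: ray_component => //; rewrite ?oppr_eq0//.
    by move=> z; exact: Iline.
  move=> z /(Iline x z Ix)[s ->].
  by exists (- s); rewrite scalerN scaleNr opprK.
split=> //.
case: (side y1 Iy1) => r1; case: (side y2 Iy2) => r2.
- by exfalso; apply: I12; rewrite -e1 -e2 (rc v)// ?(rc v)//; left.
- exists v; split=> //.
  + by move=> z; exact: Iline.
  + by rewrite -e1 (rc v)//; left.
  + by rewrite -e2 (rc (- v))//; right.
  + by exists y2.
- exists (- v); rewrite oppr_eq0 opprK; split=> //.
  + move=> z /(Iline x z Ix)[s ->].
    by exists (- s); rewrite scalerN scaleNr opprK.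
  + by rewrite -e1 (rc (- v))//; right.
  + by rewrite -e2 (rc v)//; left.
  + by exists y2.
- by exfalso; apply: I12; rewrite -e1 -e2 (rc (- v))// ?(rc (- v))//; right.
Qed.

End Interior.

(** * The convex hull of the part of K outside the interior of L *)

Section Remainder.
Context {R : realType} {d : nat}.
Local Notation E := 'rV[R]_d.
Implicit Types (A C I K L : set E) (u v w x y z : E) (s t e : R).

Lemma R_subset L K : convex K -> R_ L K `<=` K.
Proof. by move=> cK; apply: conv_hull_min => // y []. Qed.

Lemma sub_R L K : K `\` L° `<=` R_ L K.
Proof. exact: sub_conv_hull. Qed.

Lemma convex_R L K : convex (R_ L K).
Proof. exact: convex_conv_hull. Qed.

(** Near an extreme point [x] of [R_ L K], the set [K] extends to both sides of
    [x] in at most one direction: two independent directions would have a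
    nonzero combination along the hyperplane that separates [x] from [L°], and
    this hyperplane does not meet [L°], so that the corresponding segment of
    [K] centred at [x] would lie in [R_ L K]. *)
Lemma ext_R_line_direction L K u x v w : convex K -> ext (R_ L K) x ->
    (forall y, L° y -> dot u x < dot u y) ->
    K (x + v) -> K (x - v) -> v != 0 -> K (x + w) -> K (x - w) ->
  exists k, w = k *: v.
Proof.
move=> cK /(extP _ (@convex_R L K))[_ extx] hu.
pose N := [set w | K (x + w) /\ K (x - w)].
have N0 z : N z -> dot u z = 0 -> z = 0.
  move=> [Kp Km] uz; apply: extx; apply: sub_R; split=> // /hu.
    by rewrite dotDr uz addr0 ltxx.
  by rewrite dotBr uz subr0 ltxx.
have N_half z1 z2 s : N z1 -> N z2 -> `|s| <= 1 -> N (2^-1 *: (z1 + s *: z2)).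
  move=> [p1 m1] [p2 m2]; rewrite ler_norml => s1.
  pose k := (1 - s) / 2; have k01 : 0 <= k <= 1 by rewrite /k; lra.
  move/convexP: (cK) => cK'.
  have h01 : 0 <= (2^-1 : R) <= 1 by lra.
  split.
    have -> : x + 2^-1 *: (z1 + s *: z2) = (1 - 2^-1) *: (x + z1) +
        2^-1 *: ((1 - k) *: (x + z2) + k *: (x - z2)).
      by apply/rowP => i; rewrite /k !mxE; field.
    by apply: (cK') => //; exact: cK'.
  have -> : x - 2^-1 *: (z1 + s *: z2) = (1 - 2^-1) *: (x - z1) +
      2^-1 *: ((1 - k) *: (x - z2) + k *: (x + z2)).
    by apply/rowP => i; rewrite /k !mxE; field.
  by apply: (cK') => //; exact: cK'.
(* A multiple of [z2] is subtracted to get into the hyperplane through [x]; the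
   factor has absolute value at most 1, as required to stay in [K]. *)
have key z1 z2 : N z1 -> N z2 -> dot u z2 != 0 -> `|dot u z1| <= `|dot u z2| ->
    z1 = (dot u z1 / dot u z2) *: z2.
  move=> Nz1 Nz2 u2 u12; apply/eqP; rewrite -subr_eq0 -scaleNr.
  have /N0 : N (2^-1 *: (z1 + (- (dot u z1 / dot u z2)) *: z2)).
    apply: N_half => //; rewrite normrN normrM normfV.
    by rewrite ler_pdivrMr ?normr_gt0// mul1r.
  rewrite dotZr dotDr dotZr mulNr divfK// subrr mulr0 => /(_ erefl)/eqP.
  by rewrite scaler_eq0 invr_eq0 pnatr_eq0.
move=> vp vm v0 wp wm.
have Nv : N v by []. have Nw : N w by [].
have uv0 : dot u v != 0 by apply: contra_neq v0; exact: N0.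
have [h|h] := leP `|dot u w| `|dot u v|.
  by exists (dot u w / dot u v); exact: key.
have uw0 : dot u w != 0 by rewrite -normr_gt0 (le_lt_trans _ h).
have vE := key v w Nv Nw uw0 (ltW h).
exists (dot u w / dot u v); rewrite {2}vE scalerA.
have -> : dot u w / dot u v * (dot u v / dot u w) = 1 by field; apply/andP.
by rewrite scale1r.
Qed.

(** If [K] extends to both sides of [x] only along [v], the line through [x]
    cuts out a face: a segment of [K] crossing the line at [q] can be shrunk
    towards [x] to a parallel segment centred at [x]. *)
Lemma face_of_line K x v : convex K -> K (x + v) -> K (x - v) ->
    (forall w, K (x + w) -> K (x - w) -> exists k, w = k *: v) ->
  face K (K `&` [set x + s *: v | s in [set: R]]).
Proof.
move=> /[dup] cK /convexP cK' Kp Km Kline.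
apply: faceI; first 1 last.
- by move=> y [].
- move=> a b t Ka Kb /andP[t0 t1] [Kq [s _ es]].
  pose w := b - a; pose q := x + s *: v.
  have eq : q = (1 - t) *: a + t *: b by [].
  (* [z] is [x - v] or [x + v], whichever is on the other side of [x] from [q] *)
  have [l [z [l0 l1 Kz xE]]] : exists l z, [/\ 0 < l, l <= 1, K z &
      x = (1 - l) *: z + l *: q].
    have [s0|s0] := leP 0 s.
      exists (1 + s)^-1, (x - v); rewrite invr_gt0 invf_le1 ?ltr_wpDr// lerDl.
      split=> //; apply/rowP => i; rewrite !mxE; field.
      by rewrite gt_eqF// ltr_wpDr.
    exists (1 - s)^-1, (x + v); rewrite invr_gt0 invf_le1 ?subr_gt0 ?(lt_trans s0)//.
    split=> //; first by lra.
    by apply/rowP => i; rewrite !mxE; field; rewrite gt_eqF// subr_gt0 (lt_trans s0).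
  pose e := Num.min t (1 - t).
  have e0 : 0 < e by rewrite lt_min; lra.
  have et : e <= t by rewrite ge_min lexx.
  have e1t : e <= 1 - t by rewrite ge_min lexx orbT.
  have qp : K (q + e *: w).
    have -> : q + e *: w = (1 - (t + e)) *: a + (t + e) *: b by rewrite eq /w; vec.
    by apply: cK' => //; lra.
  have qm : K (q - e *: w).
    have -> : q - e *: w = (1 - (t - e)) *: a + (t - e) *: b by rewrite eq /w; vec.
    by apply: cK' => //; lra.
  have [||k ek] := Kline ((l * e) *: w).
  - have -> : x + (l * e) *: w = (1 - l) *: z + l *: (q + e *: w).
      by rewrite {1}xE; vec.
    by apply: cK' => //; lra.
  - have -> : x - (l * e) *: w = (1 - l) *: z + l *: (q - e *: w).
      by rewrite {1}xE; vec.
    by apply: cK' => //; lra.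
  have wE : w = (k / (l * e)) *: v.
    have le0 : l * e != 0 by rewrite gt_eqF// mulr_gt0.
    by apply: (scalerI le0); rewrite ek scalerA mulrCA divff// mulr1.
  split; split=> //.
    exists (s - t * (k / (l * e))) => //.
    have -> : a = q - t *: w by rewrite eq /w; vec.
    by rewrite wE /q; vec.
  exists (s + (1 - t) * (k / (l * e))) => //.
  have -> : b = q + (1 - t) *: w by rewrite eq /w; vec.
  by rewrite wE /q; vec.
- apply/convexP => y z t [Ky [r _ ey]] [Kz [s _ ez]] t01; split; first exact: cK'.
  by exists ((1 - t) * r + t * s) => //; rewrite -ey -ez; vec.
Qed.

(** The face is the line of [K] through [x]. Seen from [x], one side of it is
    separated from [L°]. A point of the other side outside [L°] would put [x]
    strictly inside a segment of [R_ L K], and a point of [L] on the first side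
    would put [x] into [L°]. *)
Lemma ext_R_sub L K x : (0 < d)%N -> convex K -> convex L -> ext (R_ L K) x ->
  (ext K `\` L°) x \/
  exists I : set E,
       [/\ face K I, has_dim I 1 &
         exists I1 I2 : set E,
           [/\ I1 <> I2, components (I `\ x) = [set I1; I2],
               I1 `<=` L° & I2 `&` L = set0]].
Proof.
move=> d0 cK cL extRx; have [Kx Lx] := ext_conv_hull extRx.
have [extKx|nextKx] := pselect (ext K x); [by left|right].
have [v [Kp Km v0]] : exists v, [/\ K (x + v), K (x - v) & v != 0].
  apply: contrapT => H; apply: nextKx; apply/(extP _ cK); split=> // v Kp Km.
  by apply/eqP; apply: contrapT => /negP v0; apply: H; exists v.
have [u hu] := separation_interior d0 cL Lx.
(* Orient [v] towards the side of [L]. *)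
wlog uv : v Kp Km v0 / 0 <= dot u v.
  move=> H; have [|/ltW uv] := leP 0 (dot u v); first exact: H.
  by apply: (H (- v)); rewrite ?opprK ?oppr_eq0 ?dotNr ?oppr_ge0.
have fI := @face_of_line K x v cK Kp Km
  (fun w => ext_R_line_direction cK extRx hu Kp Km v0).
set I := K `&` _ in fI.
have Iline z : I z -> exists s, z = x + s *: v by move=> [_ [s _ <-]]; exists s.
have Ip : I (x + v) by split=> //; exists 1 => //; rewrite scale1r.
have Im : I (x - v) by split=> //; exists (-1) => //; rewrite scaleN1r.
have Ix : I x by split=> //; exists 0 => //; rewrite scale0r addr0.
exists I; split=> //.
  by apply: (has_dim_line v0 Ix Ip) => z [].
have cI : convex I by case: fI.
exists (ray I x v), (ray I x (- v)).
have rp : ray I x v (x + v) by split=> //; exists 1; rewrite /= ?ltr01// scale1r.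
have away w : dot u w <= 0 -> ~ L° (x + w).
  by move=> uw /hu; rewrite dotDr; lra.
have Rm : R_ L K (x - v).
  by apply: sub_R; split=> //; apply: away; rewrite dotNr oppr_le0.
have rayL : ray I x v `<=` L°.
  move=> y [[Ky _] [s /= s0 ey]]; apply: contrapT => Ly.
  have Ry : R_ L K y by exact: sub_R.
  have s1 : 0 < 1 + s by rewrite addr_gt0.
  have s01 : 0 < (1 + s)^-1 < 1.
    by rewrite invr_gt0 s1 invf_lt1// ltrDl.
  have xE : x = (1 - (1 + s)^-1) *: (x - v) + (1 + s)^-1 *: y.
    by apply/rowP => i; rewrite -ey !mxE; field; rewrite gt_eqF.
  have [/eqP + _] := ext_comb (@convex_R L K) extRx Rm Ry s01 xE.
  by rewrite -subr_eq0 addrC addKr oppr_eq0 (negbTE v0).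
split=> //.
- move=> rE; have := rp; rewrite rE => -[_ [s /= s0 /addrI]] /eqP.
  rewrite scalerN eq_sym -subr_eq0 opprK -{1}[v]scale1r -scalerDl scaler_eq0.
  by rewrite (negbTE v0) orbF gt_eqF// addr_gt0.
- exact: components_line.
apply/seteqP; split=> // z [[_ [s /= s0 ez]] Lz]; apply: Lx.
have -> : x = (1 - (1 + s)^-1) *: (x + v) + (1 + s)^-1 *: z.
  by apply/rowP => i; rewrite -ez !mxE; field; rewrite gt_eqF// addr_gt0.
apply: interior_comb => //; first exact: rayL.
by rewrite invr_ge0 addr_ge0 ?(ltW s0)//= invf_lt1 ?ltrDl// addr_gt0.
Qed.

(** The points of [K] that are not on the side [I1] of the face form a convex
    set, hence contain [R_ L K]; so [x] is an end point of the intersection of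
    [R_ L K] with the face. *)
Lemma line_face_ext_R L K I I1 I2 x : convex K -> face K I -> has_dim I 1 ->
    I1 <> I2 -> components (I `\ x) = [set I1; I2] ->
    I1 `<=` L° -> I2 `&` L = set0 -> ext (R_ L K) x.
Proof.
move=> cK fI dI I12 comp I1L I2L.
have [cI IK _] := fI.
have [Ix [v [v0 Iline r1 r2 [y [Iy [s /= s0 ey]]]]]] :=
  components_line_rays cI dI I12 comp.
have Lx : ~ L° x.
  move=> /interior_normP[e e0 he].
  have vn : 0 < `|v| by rewrite normr_gt0.
  (* [x - k v] is in [I2], and so close to [x] that it would be in [L] *)
  pose k := Num.min s (e / (2 * `|v|)).
  have k0 : 0 < k by rewrite lt_min s0 divr_gt0// mulr_gt0.
  have ks : k <= s by rewrite ge_min lexx.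
  have kv : k * `|v| < e.
    apply: (@le_lt_trans _ _ (e / 2)); last by lra.
    rewrite -ler_pdivlMr// -mulrA -invfM; rewrite ge_min; apply/orP; right.
    by rewrite mulrC.
  have : (I2 `&` L) (x + k *: - v); last by rewrite I2L.
  split; last by apply: he; rewrite opprD addNKr normrN normrZ normrN gtr0_norm.
  apply: r2; split; last by exists k.
  have -> : x + k *: - v = (1 - k / s) *: x + (k / s) *: y.
    by apply/rowP => i; rewrite -ey !mxE; field; rewrite gt_eqF.
  move/convexP: cI; apply=> //; rewrite divr_ge0 ?(ltW k0) ?(ltW s0)//=.
  by rewrite ler_pdivrMr// mul1r.
pose Q := K `&` [set y | I y -> exists2 s, s <= 0 & y = x + s *: v].
have cQ : convex Q.
  apply/convex_openP => a b t [Ka Qa] [Kb Qb] t01; split.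
    by move/convex_openP: cK; exact.
  move=> /(face_comb cK fI Ka Kb t01)[/Qa[r r0 ->] /Qb[r' r'0 ->]].
  exists ((1 - t) * r + t * r'); last by vec.
  by nra.
have RQ : R_ L K `<=` Q.
  apply: conv_hull_min => // z [Kz Lz]; split=> // Iz.
  have [r er] := Iline z Iz; exists r => //; rewrite leNgt; apply/negP => r0.
  by apply: Lz; apply: I1L; apply: r1; split=> //; exists r.
apply/(extP _ (@convex_R L K)); split; first by apply: sub_R; split=> //; exact: IK.
move=> w /RQ[Kp Qp] /RQ[Km Qm].
have [/Qm[r r0 er] /Qp[s1 s10 es]] : I (x - w) /\ I (x + w).
  apply: (@face_comb _ _ K I (x - w) (x + w) 2^-1 cK fI Km Kp); first by lra.
  by have -> : (1 - 2^-1) *: (x - w) + 2^-1 *: (x + w) = x;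
    [apply/rowP => i; rewrite !mxE; field|].
have ws : w = s1 *: v by exact: (addrI x).
have wr : - w = r *: v by exact: (addrI x).
have : (r + s1) *: v = 0 by rewrite scalerDl -ws -wr addNr.
move/eqP; rewrite scaler_eq0 (negbTE v0) orbF => /eqP rs.
by rewrite ws (_ : s1 = 0) ?scale0r//; lra.
Qed.

Lemma ext_R_ext K L x : convex K -> (ext K `\` L°) x -> ext (R_ L K) x.
Proof.
move=> cK [/(extP _ cK)[Kx extx] Lx]; apply/(extP _ (@convex_R L K)).
split; first by apply: sub_R.
by move=> v /(R_subset cK) Kp /(R_subset cK) Km; exact: extx.
Qed.

Lemma convex_shift_stable A v : convex A -> convex [set x | A (x + v)].
Proof.
move=> /convexP cA; apply/convexP => x y t Ax Ay t01.
have -> : [set x | A (x + v)] ((1 - t) *: x + t *: y) =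
  A ((1 - t) *: (x + v) + t *: (y + v)) by congr A; vec.
exact: cA.
Qed.

(** Let [k] be in [K] but not in [L°], and let [v] be a recession direction of
    [K]. If the half-line from [k] along [v] is outside [L°] at some later
    point, then everything before that point is in [R_ L K]. If it stays
    inside [L°] from some point on, then [v], and by linearity [- v], is a
    recession direction of [L]; walking back along [v] would show that [k] is
    in [L°]. *)
Lemma rec_cone_R_sup L K : convex K -> closed L -> convex L ->
  is_linear_space (rec_cone L) -> rec_cone K `<=` rec_cone (R_ L K).
Proof.
move=> cK clL cL [V eV] v Kv x t Rx t0.
have : R_ L K `<=` [set x | R_ L K (x + t *: v)]; last exact.
apply: conv_hull_min; first exact/convex_shift_stable/convex_R.
move=> k [Kk Lk] /=.
have [[r rt Lr]|H] := pselect (exists2 r, t <= r & ~ L° (k + r *: v)).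
  have [r0|r0] := eqVneq r 0.
    have -> : t = 0 by lra.
    by rewrite scale0r addr0; exact: sub_R.
  have rp : 0 < r by rewrite lt_def r0 (le_trans t0).
  have -> : k + t *: v = (1 - t / r) *: k + (t / r) *: (k + r *: v).
    by apply/rowP => i; rewrite !mxE; field.
  move/convexP: (@convex_R L K); apply; try exact: sub_R.
    by apply: sub_R; split=> //; apply: Kv => //; exact: ltW.
  by rewrite divr_ge0 ?(ltW rp)//= ler_pdivrMr// mul1r.
have Lint r : t <= r -> L° (k + r *: v).
  by move=> tr; apply: contrapT => Lr; apply: H; exists r.
have Lv : rec_cone L v.
  apply: (rec_cone_from clL cL (interior_subset (Lint t (lexx t)))) => s s0.
  by rewrite -addrA -scalerDl; apply: interior_subset; apply: Lint; rewrite lerDl.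
have LNv : rec_cone L (- (t *: v)).
  have : [set` V] (- (t *: v)).
    by rewrite /= memvN memvZ//; have := Lv; rewrite eV.
  by rewrite -eV.
exfalso; apply: Lk; rewrite (_ : k = (k + t *: v) - t *: v); last by vec.
by apply: interior_rec LNv; exact: Lint.
Qed.

Lemma rec_cone_R_sub L K : closed K -> convex K -> R_ L K !=set0 ->
  rec_cone (R_ L K) `<=` rec_cone K.
Proof.
move=> clK cK [x0 Rx0] v Rv.
apply: (rec_cone_from clK cK (R_subset cK Rx0)) => t t0.
by apply: (R_subset cK); exact: Rv.
Qed.

Lemma ext_sub_ext1 K x : convex K -> ext K x -> ext_ 1 K x.
Proof.
move=> cK extx; exists [set x]; split=> //; last first.
  by exists 0 => //; exact: has_dim_set1.
apply: faceI.
- by apply/convexP => _ _ t -> -> _ /=; vec.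
- by move=> _ ->; case: extx.
- by move=> a b t Ka Kb t01 /esym /(ext_comb cK extx Ka Kb t01).
Qed.

End Remainder.

Theorem theorem3p1 (R : realType) (d : nat) (hd : (0 < d)%N)
    (K L : set 'rV[R]_d)
    (K_closed : closed K) (K_convex : convex K) (K_line_free : line_free K)
    (L_closed : closed L) (L_convex : convex L) (L_dim : has_dim L d)
    (RLK_neq0 : R_ L K !=set0) :
  (forall x : 'rV[R]_d,
    ext (R_ L K) x <->
    ((ext K `\` L°) x \/
     exists I : set 'rV[R]_d,
       [/\ face K I, has_dim I 1 &
         exists I1 I2 : set 'rV[R]_d,
           [/\ I1 <> I2, components (I `\ x) = [set I1; I2],
               I1 `<=` L° & I2 `&` L = set0]])) /\
  (is_linear_space (rec_cone L) ->
    [/\ closed (R_ L K),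
        rec_cone (R_ L K) = rec_cone K,
        R_ L K = mink_add (conv_hull (ext (R_ L K))) (rec_cone K) &
        R_ L K = mink_add (conv_hull (ext_ 1 K `\` L°)) (rec_cone K)]).
Proof.
split=> [x|rec_lin].
  split; first exact: ext_R_sub.
  case=> [|[I [fI dI [I1 [I2 [I12 comp I1L I2L]]]]]]; first exact: ext_R_ext.
  exact: line_face_ext_R fI dI I12 comp I1L I2L.
set RLK := R_ L K.
have RK : RLK `<=` K by exact: R_subset.
have cR : convex RLK by exact: convex_R.
have recKR : rec_cone K `<=` rec_cone RLK by exact: rec_cone_R_sup.
have recRK : rec_cone RLK `<=` rec_cone K by exact: rec_cone_R_sub.
have lfR C : C `<=` K -> line_free C.
  by move=> CK [a [v [v0 av]]]; apply: K_line_free; exists a, v; split=> // y /av/CK.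
have addR A : A `<=` RLK -> mink_add (conv_hull A) (rec_cone K) `<=` RLK.
  move=> AR _ [a Aa [b /recKR Rb <-]].
  rewrite -[b]scale1r; apply: Rb => //; exact: conv_hull_min Aa.
pose Rbar := closure RLK.
have RbarK : Rbar `<=` K.
  by rewrite (closure_id K).1//; exact: closure_subset.
have cRbar : convex Rbar by exact: convex_closure.
have clR : closed RLK.
  have clRbar : closed Rbar by exact: closed_closure.
  move=> x /(klee hd clRbar cRbar (lfR _ RbarK))[a aext [b bRbar <-]].
  apply: (addR (K `\` L°)); first exact: sub_R.
  exists a; last exists b => //.
    apply: conv_hull_mono aext => y exty.
    apply: (milman clRbar cRbar _ _ exty); last by case: exty.
      exact: subset_trans (@sub_R _ _ L K) (@subset_closure _ _).
    by apply: closedI => //; rewrite closedC; exact: open_interior.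
  case: RLK_neq0 => x0 Rx0.
  apply: (rec_cone_from K_closed K_convex (RK _ Rx0)) => t t0.
  by apply: RbarK; apply: bRbar => //; exact: subset_closure.
have recE : rec_cone RLK = rec_cone K by apply/seteqP.
have klR := klee hd clR cR (lfR _ RK).
split=> //.
  apply/seteqP; split; last by apply: addR => y [].
  by rewrite -recE.
apply/seteqP; split; last first.
  apply: addR => y [[F [[_ FK _] _ Fy]] Ly]; apply: sub_R; split=> //; exact: FK.
move=> y /klR[a aext [b bR <-]]; exists a; last by exists b => //; exact: recRK.
apply: conv_hull_mono aext => z extz; have [Kz Lz] := ext_conv_hull extz.
split=> //; have [[extKz _]|] := ext_R_sub hd K_convex L_convex extz.
  exact: ext_sub_ext1.
move=> [I [fI dI [I1 [I2 [I12 comp _ _]]]]].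
exists I; split=> //; first by exists 1%N.
have [cI _ _] := fI.
by have [] :=
  components_line_rays cI dI I12 comp.
Qed.
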